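(* Let $n\ge2$. If $Y\subset\mathrm{SpG}(2,2n)$ is a $T$-invariant subvariety, then $Y=\mathbb V_{M(Y)}(\mathcal Y)$ for a unique $M(Y)\in M^2_{BC_n}(\mathbb C)$ and a subvariety $\mathcal Y\subset\mathrm{Sp}\mathcal G_{M(Y)}$.
   Context: Work over $\mathbb C$. Let $E_n=[n]\cup[n^*]$, identified with $[2n]$ via $i^*=2n+1-i$, and $J_n^2=\{\{i,j\}\in\binom{E_n}{2}:j\ne i^*\}$. $\mathrm{SpG}(2,2n)=G(2,2n)\cap\{\sum_{i=1}^nx_{i,i^*}=0\}$ is the symplectic Grassmannian of isotropic $2$-planes in $\mathbb C^{2n}$, in Plücker coordinates $[x_{i,j}]$. $T$ is the $n$-dimensional torus of matrices $t=\mathrm{diag}(t_1,\dots,t_{2n})=\mathrm{diag}(\mu_1,\dots,\mu_n,\mu_n^{-1},\dots,\mu_1^{-1})$ acting by $t\cdot[x_{i,j}]=[t_it_jx_{i,j}]$. For $x\in\mathrm{SpG}(2,2n)$, $M(x)=(E_n,*,\{\{i,j\}\in J_n^2:x_{i,j}\neq0\})$ is its $BC_n$-matroid (symplectic matroid of rank $2$); $M^2_{BC_n}(\mathbb C)$ is the set of $\mathbb C$-representable ones, i.e. those of the form $M(x)$. For $N\in M^2_{BC_n}(\mathbb C)$, the symplectic thin Schubert cell is $\mathrm{SpG}_N=\{x\in\mathrm{SpG}(2,2n):M(x)=N\}$, an irreducible $T$-invariant locally closed subset, and $\mathrm{Sp}\mathcal G_N=\mathrm{SpG}_N/T$ is its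 universal geometric quotient (an irreducible, possibly non-separated, scheme). A subvariety is a closed subscheme that is reduced and irreducible. For a subvariety $\mathcal Y\subset\mathrm{Sp}\mathcal G_N$, define $\mathbb V_N(\mathcal Y)=\overline{\mathcal Y\times_{\mathrm{Sp}\mathcal G_N}\mathrm{SpG}_N}\subset\mathrm{SpG}(2,2n)$, the closure of the preimage of $\mathcal Y$ under the quotient map. *)

(* Defs.v *)
From HB Require Import structures.
From mathcomp Require Import all_boot all_order all_algebra.
From mathcomp Require Import generic_quotient.
From mathcomp Require Import complex ring.
From mathcomp Require Import all_classical all_reals.
From mathcomp Require Import topology_theory.topology.
(* the notations of mpoly clash with those of analysis *)
From mathcomp Require Import -(notations) mpoly.

Set Implicit Arguments.
Unset Strict Implicit.
Unset Printing Implicit Defensive.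

Import Order.TTheory GRing.Theory Num.Theory.
Local Open Scope classical_set_scope.
Local Open Scope ring_scope.
Local Open Scope quotient_scope.

(* Everything is in the classical language of varieties over the algebraically
   closed field C = R[i]: the points of a space are its closed points, and a
   closed subscheme that is reduced and irreducible is given by its underlying
   set, an irreducible closed subset. *)

Definition irreducible_set (X : topologicalType) (A : set X) : Prop :=
  A !=set0 /\
  forall B1 B2 : set X, closed B1 -> closed B2 -> A `<=` B1 `|` B2 ->
    A `<=` B1 \/ A `<=` B2.

Definition subvariety (X : topologicalType) (A : set X) : Prop :=
  closed A /\ irreducible_set A.

(* E_n = [2n] numbered from 0, so that i^* = 2n - 1 - i. *)
Definition E (n : nat) : finType := 'I_(n + n).
Definition star (n : nat) (i : E n) : E n := rev_ord i.

Definition J2 (n : nat) : {set {set E n}} :=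
  [set A : {set E n} | (#|A| == 2)%N && [forall i in A, star i \notin A]]%SET.

Section ProjectiveSpace.
Variable R : realType.
Local Notation C := (R[i]).

(* Homogeneous coordinates on P(/\^2 C^m): the array (x_(i,j)) with i, j in
   [m] and x_(j,i) = - x_(i,j), i.e. a nonzero skew-symmetric matrix. *)
Definition is_plvec (m : nat) (x : 'M[C]_m) : bool := (x != 0) && (x^T == - x).
Definition plvec (m : nat) := {x : 'M[C]_m | is_plvec x}.

Definition proportional (m : nat) (x y : plvec m) : bool :=
  `[< exists2 c : C, c != 0 & val y = c *: val x >].

Lemma proportional_equiv (m : nat) : equiv_class_of (@proportional m).
Proof.
split.
- by move=> x; apply/asboolP; exists 1; rewrite ?oner_neq0 ?scale1r.
- move=> x y; apply/asboolP/asboolP => -[c c0 e].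
    by exists c^-1; rewrite ?invr_eq0// e scalerA mulVf// scale1r.
  by exists c^-1; rewrite ?invr_eq0// e scalerA mulVf// scale1r.
- move=> y x z /asboolP[c c0 e] /asboolP[d d0 f]; apply/asboolP.
  by exists (d * c); rewrite ?mulf_neq0// f e scalerA.
Qed.

Canonical proportional_equiv_rel (m : nat) :=
  EquivRelPack (@proportional_equiv m).

Definition pspace (m : nat) := {eq_quot (@proportional m)}.
HB.instance Definition _ (m : nat) := Choice.on (pspace m).
HB.instance Definition _ (m : nat) := EqQuotient.on (pspace m).

Definition coord (m : nat) (p : pspace m) : 'M[C]_m := val (repr p : plvec m).

(* The Zariski topology; polynomials are in the m * m coordinates x_(i,j), which
   are linearly redundant. *)
Definition poly_at (m : nat) (f : mpoly (m * m) C) (x : 'M[C]_m) : C :=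
  meval (fun k => mxvec x 0 k) f.

Definition homogeneous (m : nat) : set (mpoly (m * m) C) :=
  [set f | f \is ishomog (@mdeg (m * m))].

Definition zero_locus (m : nat) (S : set (mpoly (m * m) C)) :
    set (pspace m) :=
  [set p | forall f, S f -> poly_at f (coord p) = 0].

Definition zariski_open (m : nat) (U : set (pspace m)) : Prop :=
  exists2 S, S `<=` @homogeneous m & ~` U = zero_locus S.

Lemma zariski_openT m : @zariski_open m setT.
Proof.
exists [set 1].
  by move=> _ ->; apply/homogP; exists 0%N; exact: dhomog1.
rewrite setCT; apply/seteqP; split => p // /(_ 1 erefl).
by rewrite /poly_at meval1 => /eqP; rewrite oner_eq0.
Qed.

Lemma zariski_openI m : setI_closed (@zariski_open m).
Proof.
move=> U V [S hS eU] [S' hS' eV].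
exists [set f | exists f1 f2, [/\ S f1, S' f2 & f = f1 * f2]].
  move=> _ [f1 [f2 [/hS/homogP[d1 h1] /hS'/homogP[d2 h2] ->]]].
  by apply/homogP; exists (d1 + d2)%N; exact: dhomogM.
rewrite setCI eU eV; apply/seteqP; split => p.
  move=> [] h _ [f1 [f2 [s1 s2 ->]]]; rewrite /poly_at mevalM.
    by have := h _ s1; rewrite /poly_at => ->; rewrite mul0r.
  by have := h _ s2; rewrite /poly_at => ->; rewrite mulr0.
move=> h; have [hp|] := pselect (zero_locus S p); first by left.
move=> /existsNP[f1 /not_implyP[s1 n1]]; right => f2 s2.
have : poly_at (f1 * f2) (coord p) = 0 by apply: h; exists f1, f2.
by rewrite /poly_at mevalM => /eqP; rewrite mulf_eq0 => /orP[]/eqP.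
Qed.

Lemma zariski_open_bigcup m (I : Type) (U : I -> set (pspace m)) :
  (forall i, zariski_open (U i)) -> zariski_open (\bigcup_i U i).
Proof.
move=> oU.
exists [set f | homogeneous f /\
                exists i, forall p, (~` U i) p -> poly_at f (coord p) = 0].
  by move=> f [].
rewrite setC_bigcup; apply/seteqP; split => p.
  by move=> h f [_ [i hf]]; apply: hf; exact: h.
move=> h i _; have [S hS e] := oU i; rewrite e => f Sf; apply: h; split.
  exact: hS.
by exists i => q; rewrite e; apply.
Qed.

HB.instance Definition _ (m : nat) :=
  isOpenTopological.Build (pspace m)
    (@zariski_openT m) (@zariski_openI m) (@zariski_open_bigcup m).

(* The Plucker coordinates of the row space of A. As the basis of a plane W
   varies, plucker A runs over all the nonzero multiples of one vector. *)
Definition plucker (m : nat) (A : 'M[C]_(2, m)) : 'M[C]_m :=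
  \matrix_(i, j) (A 0 i * A 1 j - A 0 j * A 1 i).

Definition Gr2 (m : nat) : set (pspace m) :=
  [set p | exists2 A : 'M[C]_(2, m), row_free A & coord p = plucker A].

End ProjectiveSpace.

Section Symplectic.
Variables (R : realType) (n : nat).
Local Notation C := (R[i]).

Definition SpG : set (pspace R (n + n)) :=
  [set p | @Gr2 R (n + n) p /\
    \sum_(i < n) coord p (lshift n i) (star (lshift n i)) = 0].

Definition is_torus (mu : 'rV[C]_n) : bool := [forall i, mu 0 i != 0].
Definition torus := {mu : 'rV[C]_n | is_torus mu}.

(* (t_1, ..., t_2n) = (mu_1, ..., mu_n, mu_n^-1, ..., mu_1^-1) *)
Definition tdiag (t : torus) : 'rV[C]_(n + n) :=
  row_mx (val t) (\row_i (val t 0 (rev_ord i))^-1).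

Definition tscale (t : torus) (x : 'M[C]_(n + n)) : 'M[C]_(n + n) :=
  \matrix_(i, j) (tdiag t 0 i * tdiag t 0 j * x i j).

Lemma tscaleE (t : torus) x i j :
  tscale t x i j = tdiag t 0 i * tdiag t 0 j * x i j.
Proof. by rewrite /tscale mxE. Qed.

Lemma star_lshift (i : 'I_n) : star (lshift n i) = rshift n (rev_ord i).
Proof. by apply: val_inj => /=; rewrite addnBA. Qed.

Lemma tdiag_neq0 (t : torus) i : tdiag t 0 i != 0.
Proof.
have /forallP t0 := valP t; rewrite /tdiag.
by case: (split_ordP i) => j ->; rewrite ?row_mxEl ?row_mxEr ?mxE ?invr_eq0.
Qed.

Lemma tdiag_star (t : torus) (i : 'I_n) :
  tdiag t 0 (lshift n i) * tdiag t 0 (star (lshift n i)) = 1.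
Proof.
have /forallP t0 := valP t.
by rewrite star_lshift /tdiag row_mxEl row_mxEr mxE rev_ordK mulfV.
Qed.

Lemma tscale_plvec (t : torus) (x : plvec R (n + n)) :
  is_plvec (tscale t (val x)).
Proof.
have /andP[x0 /eqP xT] := valP x; apply/andP; split.
  apply: contra_neq x0 => /matrixP h; apply/matrixP => i j; rewrite mxE.
  have /eqP := h i j.
  by rewrite tscaleE [X in _ == X]mxE !mulf_eq0 !(negbTE (tdiag_neq0 _ _)) => /eqP.
apply/eqP/matrixP => i j; have /matrixP/(_ i j) := xT.
rewrite [LHS]mxE [X in _ = X -> _]mxE => e.
rewrite [LHS]mxE [RHS]mxE !tscaleE e mulrN; congr (- (_ * _)); exact: mulrC.
Qed.

Definition tact_proj (t : torus) (p : pspace R (n + n)) : pspace R (n + n) :=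
  \pi_(pspace R (n + n))
    (exist (@is_plvec R (n + n)) (tscale t (coord p)) (tscale_plvec t (repr p))).

Lemma coord_tact (t : torus) p :
  exists2 c : C, c != 0 & coord (tact_proj t p) = c *: tscale t (coord p).
Proof.
rewrite /tact_proj; set v := exist _ _ _.
have /eqmodP/asboolP[c c0 e] : v = repr (\pi_(pspace R (n + n)) v)
  %[mod pspace R (n + n)] by rewrite reprK.
by exists c.
Qed.

Lemma tact_SpG (t : torus) p : SpG p -> SpG (tact_proj t p).
Proof.
move=> [[A fA eA] iso]; have [c c0 e] := coord_tact t p; split; last first.
  transitivity (c * \sum_(i < n) coord p (lshift n i) (star (lshift n i))).
    rewrite mulr_sumr; apply: eq_bigr => i _.
    by rewrite e mxE tscaleE tdiag_star mul1r.
  by rewrite iso mulr0.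
pose D : 'M[C]_2 := diag_mx (\row_i (if i == 0 then c else 1)).
pose B := D *m A *m diag_mx (tdiag t).
have eB i j : B i j = (if i == 0 then c else 1) * A i j * tdiag t 0 j.
  by rewrite /B mul_mx_diag mxE mul_diag_mx mxE [in LHS]mxE.
exists B; last first.
  apply/matrixP => i j; rewrite e [LHS]mxE tscaleE eA.
  rewrite [plucker A _ _]mxE [plucker B _ _]mxE !eB /= !mul1r.
  by ring.
rewrite /row_free /B mxrankMfree; last first.
  rewrite row_free_unit unitmxE det_diag unitfE; apply/prodf_neq0 => i _.
  exact: tdiag_neq0.
rewrite eqmxMfull // row_full_unit unitmxE det_diag unitfE.
apply/prodf_neq0 => i _; rewrite mxE; case: ifP => _ //; exact: oner_neq0.
Qed.

Definition tact (t : torus) (x : SpG) : SpG :=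
  SigSub (mem_set (tact_SpG t (set_mem (valP x)))).

Lemma coord_eqP (p q : pspace R (n + n)) :
  p = q <-> exists2 c : C, c != 0 & coord q = c *: coord p.
Proof.
split=> [->|h]; first by exists 1; rewrite ?oner_neq0 ?scale1r.
by rewrite -(reprK p) -(reprK q); apply/eqmodP/asboolP.
Qed.

Lemma tact_eqP (t : torus) (x y : SpG) :
  y = tact t x <->
  exists2 c : C, c != 0 & coord (val y) = c *: tscale t (coord (val x)).
Proof.
have [d d0 e] := coord_tact t (val x); split=> [->|[c c0 f]].
  by exists d.
apply: val_inj; apply/esym/coord_eqP; exists (c / d).
  by rewrite mulf_neq0 // invr_eq0.
by rewrite e f scalerA divfK.
Qed.

Lemma torus1_subproof : is_torus (const_mx 1).
Proof. by apply/forallP => i; rewrite mxE oner_neq0. Qed.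
Definition torus1 : torus := exist is_torus _ torus1_subproof.

Lemma torusV_subproof (t : torus) :
  is_torus (\row_i (val t 0 i)^-1).
Proof.
by apply/forallP => i; rewrite mxE invr_eq0; have /forallP := valP t; apply.
Qed.
Definition torusV (t : torus) : torus := exist is_torus _ (torusV_subproof t).

Lemma torusM_subproof (s t : torus) :
  is_torus (\row_i (val s 0 i * val t 0 i)).
Proof.
apply/forallP => i; rewrite mxE mulf_neq0 //.
  by have /forallP := valP s; apply.
by have /forallP := valP t; apply.
Qed.
Definition torusM (s t : torus) : torus := exist is_torus _ (torusM_subproof s t).

Lemma tdiag1 i : tdiag torus1 0 i = 1.
Proof.
rewrite /tdiag.
by case: (split_ordP i) => j ->; rewrite ?row_mxEl ?row_mxEr !mxE ?invr1.
Qed.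

Lemma tdiagV t i : tdiag (torusV t) 0 i = (tdiag t 0 i)^-1.
Proof.
rewrite /tdiag.
by case: (split_ordP i) => j ->; rewrite ?row_mxEl ?row_mxEr !mxE.
Qed.

Lemma tdiagM s t i : tdiag (torusM s t) 0 i = tdiag s 0 i * tdiag t 0 i.
Proof.
rewrite /tdiag.
by case: (split_ordP i) => j ->; rewrite ?row_mxEl ?row_mxEr !mxE ?invfM.
Qed.

Lemma tact1 x : tact torus1 x = x.
Proof.
apply/esym/tact_eqP; exists 1; rewrite ?oner_neq0 // scale1r.
by apply/matrixP => i j; rewrite tscaleE !tdiag1 !mul1r.
Qed.

Lemma tactM s t x : tact (torusM s t) x = tact s (tact t x).
Proof.
apply/esym/tact_eqP; have [c c0 e] := coord_tact s (val (tact t x)).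
have [d d0 f] := coord_tact t (val x).
exists (c * d); first by rewrite mulf_neq0.
rewrite [LHS]e -scalerA; congr (_ *: _); apply/matrixP => i j.
rewrite tscaleE [coord _ i j](congr1 (fun A : 'M_(n + n) => A i j) f).
rewrite [X in _ * X = _]mxE [RHS]mxE !tscaleE !tdiagM.
by ring.
Qed.

Lemma tactK t x : tact (torusV t) (tact t x) = x.
Proof.
rewrite -tactM (_ : torusM _ _ = torus1) ?tact1 //; apply: val_inj.
apply/rowP => i; rewrite !mxE mulVf //.
by have /forallP := valP t; apply.
Qed.

Definition T_invariant (Y : set SpG) : Prop :=
  forall t x, Y x -> Y (tact t x).

(* A BC_n-matroid of rank 2 is recorded by its set of bases; the other two
   components of (E_n, *, B) depend only on n. *)
Definition BCmatroid (x : SpG) : {set {set E n}} :=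
  [set A in J2 n | [exists i, exists j,
     (A == [set i; j]) && (coord (val x) i j != 0)]]%SET.

Definition representable : set {set {set E n}} := range BCmatroid.

Definition SpG_cell (N : {set {set E n}}) : set SpG :=
  [set x | BCmatroid x = N].

Section Quotient.
Variable N : {set {set E n}}.

Definition same_orbit (x y : SpG_cell N) : bool :=
  `[< exists t : torus, val y = tact t (val x) >].

Lemma same_orbit_equiv : equiv_class_of same_orbit.
Proof.
split.
- by move=> x; apply/asboolP; exists torus1; rewrite tact1.
- by move=> x y; apply/asboolP/asboolP => -[t e]; exists (torusV t);
    rewrite e tactK.
- move=> y x z /asboolP[s e] /asboolP[t f]; apply/asboolP.
  by exists (torusM t s); rewrite f e tactM.
Qed.

Canonical same_orbit_equiv_rel := EquivRelPack same_orbit_equiv.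

(* The space of closed points of the geometric quotient SpG_N / T: the set of
   T-orbits, with the quotient of the Zariski topology of SpG_N. *)
Definition SpG_quot := quotient_topology {eq_quot same_orbit}.
Definition quot_map : SpG_cell N -> SpG_quot := \pi_SpG_quot.

Definition VV (Z : set SpG_quot) : set SpG :=
  closure (set_val @` (quot_map @^-1` Z)).

End Quotient.
End Symplectic.

Arguments SpG R n _ : clear implicits.
Arguments representable R n _ : clear implicits.
Arguments SpG_cell R {n} N _.
Arguments SpG_quot R {n} N.

(* Main.v *)
Require Import Defs.
From mathcomp Require Import all_boot all_algebra.
From mathcomp Require Import all_classical all_reals.
From mathcomp Require Import topology_theory.topology.
From mathcomp Require Import generic_quotient complex.
From mathcomp Require Import -(notations) mpoly.

(** The matroid attached to Y is the generic one, [generic_matroid Y]: a pair A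
is a basis when the coordinate x_A does not vanish identically on Y.  For each
of its finitely many bases A the locus x_A = 0 is closed and does not contain
Y, so by irreducibility these loci do not cover Y, and their complement in Y,
which is the intersection U of Y with the thin Schubert cell of
[generic_matroid Y], is nonempty and dense in Y ([dense_generic_cell]).

Existence: U is T-invariant, so it is the preimage of its image Z in the
quotient ([quot_map_saturated]).  Hence Z is closed; it is irreducible because
U, being dense in the irreducible Y, is irreducible, and so are continuous
images.  The closure of the preimage of Z is the closure of U, which is Y.

Uniqueness: if Y is the closure of a nonempty subset of the cell of N, then
x_A, for A in J_n^2, vanishes identically on Y exactly when A is not a basis of
N, so N = [generic_matroid Y] ([generic_matroid_VV]). *)

Local Open Scope classical_set_scope.
Local Open Scope ring_scope.

(** An irreducible set contained in a finite union of closed sets is contained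
in B as soon as it is contained in none of the other members F i. *)
Lemma irreducible_cover (X : topologicalType) (I : eqType) (s : seq I)
    (F : I -> set X) (A B : set X) :
  irreducible_set A -> closed B ->
  (forall i, i \in s -> closed (F i) /\ ~ A `<=` F i) ->
  A `<=` B `|` [set x | exists2 i, i \in s & F i x] -> A `<=` B.
Proof.
move=> [_ irrA]; elim: s B => [|i s IHs] B cB sF AB.
  by move=> x /AB[//|[]].
have [cF nF] := sF i (mem_head _ _).
have : A `<=` F i `|` B.
  apply: IHs => [||x /AB[Bx|[j]]].
  - exact: closedU.
  - by move=> j js; apply: sF; rewrite inE js orbT.
  - by left; right.
  - rewrite inE => /orP[/eqP->|js] Fx; first by left; left.
    by right; exists j.
by move=> /(irrA _ _ cF cB)[].
Qed.

Lemma irreducible_image (X Z : topologicalType) (f : X -> Z) (A : set X) :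
  continuous f -> irreducible_set A -> irreducible_set (f @` A).
Proof.
move=> cf [[a Aa] irrA]; split=> [|B1 B2 cB1 cB2 AB].
  by exists (f a); exists a.
have cpre B : closed B -> closed (f @^-1` B).
  by move=> cB; apply: preimage_closed => // x _; exact: cf.
have [x Ax|AB1|AB2] := irrA _ _ (cpre _ cB1) (cpre _ cB2).
- by have [|] := AB (f x) (ex_intro2 _ _ x Ax erefl); [left|right].
- by left=> _ [x Ax <-]; exact: AB1.
- by right=> _ [x Ax <-]; exact: AB2.
Qed.

Lemma set_val_continuous (X : topologicalType) (S : set X) :
  continuous (set_val : S -> X).
Proof. exact: initial_continuous. Qed.

Lemma closed_set_val (X : topologicalType) (S : set X) (B : set S) :
  closed B -> exists2 D : set X, closed D & set_val @^-1` D = B.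
Proof.
rewrite -openC => -[U oU eU]; exists (~` U); first by rewrite closedC.
by rewrite preimage_setC; apply: setC_inj; rewrite setCK.
Qed.

Lemma set_val_preimage_image (X : Type) (S Y : set X) :
  set_val @` (set_val @^-1` Y : set S) = Y `&` S.
Proof.
apply/seteqP; split=> [_ [x Yx <-]|x [Yx Sx]].
  by split=> //; have := valP x; rewrite inE.
by exists (SigSub (mem_set Sx)).
Qed.

(** The trace on S of an irreducible set is irreducible in S when it is dense. *)
Lemma irreducible_set_val (X : topologicalType) (S Y : set X) :
  irreducible_set Y -> Y `<=` closure (Y `&` S) ->
  irreducible_set (set_val @^-1` Y : set S).
Proof.
move=> [[y Yy] irrY] dense; split=> [|B1 B2 cB1 cB2 YB].
  have [x [[Yx Sx] _]] := dense y Yy setT filterT.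
  by exists (SigSub (mem_set Sx)).
have [D1 cD1 eD1] := closed_set_val _ _ _ cB1.
have [D2 cD2 eD2] := closed_set_val _ _ _ cB2.
have : Y `<=` D1 `|` D2.
  have cD : closed (D1 `|` D2) by exact: closedU.
  move=> x /dense; rewrite [D1 `|` D2](closure_id _).1//; apply: closure_subset.
  rewrite -set_val_preimage_image => _ [z Yz <-].
  by have := YB z Yz; rewrite -eD1 -eD2.
by move=> /(irrY _ _ cD1 cD2)[] YD; [left; rewrite -eD1|right; rewrite -eD2];
  move=> z; exact: YD.
Qed.

Section Cells.
Variables (R : realType) (n : nat).
Implicit Types (Y : set (SpG R n)) (N : {set {set E n}}).

Lemma closed_coord_eq0 m (i j : 'I_m) :
  closed [set p : pspace R m | Defs.coord p i j = 0].
Proof.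
rewrite -openC; exists [set mpolyX R[i] (mnm1 (mxvec_index i j))].
  by move=> _ ->; apply/homogP; exists (mdeg (mnm1 (mxvec_index i j)));
    rewrite dhomogX eqxx.
rewrite setCK; apply/seteqP; split=> p /=.
  by move=> p0 _ ->; rewrite /poly_at mevalXU mxvecE.
by move=> /(_ _ erefl); rewrite /poly_at mevalXU mxvecE.
Qed.

(** A pair outside J_n^2 is never a basis, and a pair A in J_n^2 fails to be one
exactly when x_(i,j) = 0 for both orderings (i, j) of A. *)
Lemma closed_nonbasis (A : {set E n}) :
  closed [set x : SpG R n | A \notin BCmatroid x].
Proof.
have [AJ|AJ] := boolP (A \in J2 n); last first.
  rewrite (_ : [set _ | _] = setT); first exact: closedT.
  by apply/seteqP; split=> // x _ /=; rewrite inE (negbTE AJ).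
rewrite (_ : [set _ | _] =
    \bigcap_(ij in [set ij : E n * E n | A = [set ij.1; ij.2]%SET])
      set_val @^-1` [set p : pspace R (n + n) | Defs.coord p ij.1 ij.2 = 0]).
  apply: closed_bigI => ij _; apply: preimage_closed; last exact: closed_coord_eq0.
  by move=> x _; exact: set_val_continuous.
apply/seteqP; split=> x /=; rewrite inE AJ /=.
  move=> xA [i j] /= eA; apply/eqP; apply: contraNT xA => xij.
  by apply/existsP; exists i; apply/existsP; exists j; rewrite eA eqxx.
move=> xA; apply/existsP => -[i /existsP[j /andP[/eqP eA /eqP]]]; apply.
exact: (xA (i, j)).
Qed.

(** The matroid of a generic point of Y, recorded by its set of bases: the pairs
that are a basis of M(x) for at least one point x of Y.  It makes sense for any
set Y; when Y is irreducible, it is the matroid of a point of Y. *)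
Definition generic_matroid Y : {set {set E n}} :=
  [set A in J2 n | `[< exists2 x, Y x & A \in BCmatroid x >]]%SET.

Lemma BCmatroid_sub_generic Y x : Y x -> {subset BCmatroid x <= generic_matroid Y}.
Proof.
move=> Yx A Ax; rewrite inE; apply/andP; split.
  by move: Ax; rewrite inE => /andP[].
by apply/asboolP; exists x.
Qed.

(** The points of Y outside the cell of the generic matroid are those at which
some generic basis fails to be a basis. *)
Lemma dense_generic_cell Y : irreducible_set Y ->
  Y `<=` closure (Y `&` SpG_cell R (generic_matroid Y)).
Proof.
move=> irrY; set N := generic_matroid Y.
apply: (irreducible_cover _ _ (enum N)
          (fun A => [set x : SpG R n | A \notin BCmatroid x])) => //.
- exact: closed_closure.
- move=> A; rewrite mem_enum inE => /andP[_ /asboolP[x Yx Ax]].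
  by split; [exact: closed_nonbasis|move=> /(_ x Yx)/=; rewrite Ax].
- move=> x Yx; have [xN|xN] := eqVneq (BCmatroid x) N.
    by left; apply: subset_closure.
  right; have : ~~ (N \subset BCmatroid x).
    apply: contra_neqN xN => Nx; apply/eqP; rewrite finset.eqEsubset Nx andbT.
    by apply/fintype.subsetP; exact: BCmatroid_sub_generic.
  by move=> /fintype.subsetPn[A AN Ax]; exists A; rewrite ?mem_enum.
Qed.

(** The part W of a T-invariant set that lies in a cell is a union of fibres of
the quotient map. *)
Lemma quot_map_saturated N Y : T_invariant Y ->
  let W := set_val @^-1` Y : set (SpG_cell R N) in
  quot_map (N := N) @^-1` (quot_map (N := N) @` W) = W.
Proof.
move=> invY W; apply/seteqP; split=> [x [y Wy /eqmodP/asboolP[t e]]|x Wx].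
  rewrite /W /preimage /=.
  by rewrite set_valE e; exact: invY.
by exists x.
Qed.

Lemma VV_quot_map N Y : T_invariant Y ->
  VV (quot_map (N := N) @` (set_val @^-1` Y)) = closure (Y `&` SpG_cell R N).
Proof. by move=> invY; rewrite /VV quot_map_saturated// set_val_preimage_image. Qed.

Lemma subvariety_quot_map N Y : subvariety Y -> T_invariant Y ->
  Y `<=` closure (Y `&` SpG_cell R N) ->
  subvariety (quot_map (N := N) @` (set_val @^-1` Y)).
Proof.
move=> [cY irrY] invY dense; split.
  rewrite -openC /open /= /quotient_open preimage_setC openC.
  rewrite [X in closed X](quot_map_saturated N Y invY).
  by apply: preimage_closed => // x _; exact: set_val_continuous.
by apply: irreducible_image; [exact: pi_continuous|exact: irreducible_set_val].
Qed.

(** The matroid N is recovered from the closure of any nonempty part of its cell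
that comes from the quotient: a basis of N is attained at the points of that
part, and the vanishing of the other coordinates passes to the closure. *)
Lemma generic_matroid_VV N (Z : set (SpG_quot R N)) :
  representable R n N -> Z !=set0 -> generic_matroid (VV Z) = N.
Proof.
move=> [x0 _ eN] [z Zz]; apply/setP => A; rewrite inE.
have [AN|AN] := boolP (A \in N).
  rewrite (_ : A \in J2 n) /=; last by move: AN; rewrite -eN inE => /andP[].
  have zr : quot_map (repr z) = z by exact: reprK.
  apply/asboolP; exists (set_val (repr z)).
    by apply: subset_closure; exists (repr z); rewrite /= ?zr.
  by have := valP (repr z); rewrite inE /SpG_cell /= => ->.
apply/negbTE/negP => /andP[_ /asboolP[x Zx]]; apply/negP.
have := closed_nonbasis A => /closure_id.
suff: (VV Z `<=` closure [set x : SpG R n | A \notin BCmatroid x]).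
  by move=> sub eA; have := sub x Zx; rewrite -eA.
apply: closure_subset => _ [y _ <-] /=.
by have := valP y; rewrite inE /SpG_cell /= => ->.
Qed.

End Cells.

Theorem theorem5p3 (R : realType) (n : nat) (hn : (2 <= n)%N)
    (Y : set (SpG R n)) (subY : subvariety Y) (invY : T_invariant Y) :
  exists! N : {set {set E n}},
    representable R n N /\
    exists Z : set (SpG_quot R N), subvariety Z /\ Y = VV Z.
Proof.
have [cY irrY] := subY; have dense := dense_generic_cell _ _ Y irrY.
exists (generic_matroid R n Y); split; last first.
  move=> N [repN [Z [[_ [Z0 _]] ->]]].
  exact: generic_matroid_VV.
split.
  have [[y Yy] _] := irrY; have [x [[_ xN] _]] := dense y Yy setT filterT.
  by exists x.
exists (quot_map (N := generic_matroid R n Y) @` (set_val @^-1` Y)).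
split; first exact: subvariety_quot_map.
rewrite VV_quot_map//; apply/seteqP; split=> //.
by move=> x /(closure_subset (@subIsetl _ _ _)); rewrite -(closure_id Y).1.
Qed.
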